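(* Let $r,s\ge1$ be integers, let $\widehat Q=\sum_{i=1}^sA_iw^{-i}$ be a $(\dot\varphi,r)$-Galois-closed irregular type, let $g'\in W$ be an element generating its $(\dot\varphi,r)$-Galois-orbit, and set $\mathbf g=\dot\varphi g'\in GL(\mathfrak t)$. For $i\in\{1,\dots,s\}$ define $$\mathbf B_{\mathbf g,r}(\widehat Q,i)=\mathfrak t_{\phi_i}(\mathbf g_{\phi_i},\zeta_r^i)\setminus\bigcup_{\alpha\in\phi_{i+1}\setminus\phi_i}\bigl(H_\alpha\cap\mathfrak t_{\phi_i}(\mathbf g_{\phi_i},\zeta_r^i)\bigr).$$ Then there is a direct-product decomposition $\mathbf B_{\mathbf g,r}(\widehat Q)=\prod_{i=1}^s\mathbf B_{\mathbf g,r}(\widehat Q,i)\subset\mathfrak t^s$.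
   Context: $G$ is a connected complex reductive algebraic group with maximal torus $T$, Lie algebras $\mathfrak t\subset\mathfrak g$, root system $\Phi$, Weyl group $W$; $\mathfrak g'=[\mathfrak g,\mathfrak g]$, $\mathfrak t'=\mathfrak t\cap\mathfrak g'$, so that $\mathfrak t=\mathfrak Z(\mathfrak g)\oplus\mathfrak t'$, and $\Phi'$ is the root system of $(\mathfrak g',\mathfrak t')$, with the same Weyl group $W$. $H_\alpha=\ker\alpha\subset\mathfrak t$; $\zeta_r=e^{2\pi\sqrt{-1}/r}$; $V(g,\zeta)=\ker(g-\zeta\,\mathrm{Id}_V)$. Fix an outer automorphism $\dot\varphi=(f,\dot\varphi')\in\mathrm{Out}(\mathfrak g)\simeq GL(\mathfrak Z(\mathfrak g))\times\mathrm{Out}(\Phi')$, with $f$ of finite order, where $\mathrm{Out}(\Phi')=\mathrm{Aut}(\Phi')/W$ is identified with the subgroup of $\mathrm{Aut}(\Phi')$ preserving a chosen base of simple roots; $\dot\varphi$ is viewed as a linear automorphism of $\mathfrak t$. An irregular type is $\widehat Q=\sum_{i=1}^sA_iw^{-i}$, $A_i\in\mathfrak t$, identified with $(A_1,\dots,A_s)\in\mathfrak t^s$. An element $g'\in W$ generates its $(\dot\varphi,r)$-Galois-orbit if $\dot\varphi g'(A_i)=\zeta_r^iA_i$ for all $i$; $\widehat Q$ is $(\dot\varphi,r)$-Galois-closed if such $g'$ exists. Let $d_\alpha(\widehat Q)$ be the pole order in $w$ of $\sum_i\alpha(A_i)w^{-i}$ ($0$ if this vanishes), $\alpha\in\Phi$.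 $\mathbf B_{\mathbf g,r}(\widehat Q)\subset\mathfrak t^s$ is the space of $\widehat Q'$ of irregularity at most $s$ whose $(\dot\varphi,r)$-Galois-orbit is generated by $g'$ and with $d_\alpha(\widehat Q')=d_\alpha(\widehat Q)$ for all $\alpha\in\Phi$. $\phi_i=\{\alpha\in\Phi:\alpha(A_i)=\dots=\alpha(A_s)=0\}$ for $1\le i\le s$, $\phi_{s+1}=\Phi$; $\mathfrak t_{\phi}=\bigcap_{\alpha\in\phi}H_\alpha$; $\mathbf g$ preserves each $\mathfrak t_{\phi_i}$ and $\mathbf g_{\phi_i}$ is its restriction. *)

(* Defs.v *)
From HB Require Import structures.
From mathcomp Require Import all_boot all_order all_algebra.
From mathcomp Require Import all_classical all_reals all_analysis.
From mathcomp Require Import complex.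
From mathcomp Require mpoly.

Set Implicit Arguments.
Unset Strict Implicit.
Unset Printing Implicit Defensive.

Import Order.TTheory GRing.Theory Num.Theory.

Local Open Scope classical_set_scope.
Local Open Scope ring_scope.

Section LinearSpan.
Variables (K : fieldType) (V : vectType K).

Definition is_linear_span (S : set V) : set {vspace V} :=
  [set U : {vspace V} | (forall x, S x -> x \in U) /\
     forall U' : {vspace V}, (forall x, S x -> x \in U') -> (U <= U')%VS].

(* The smallest subspace containing S; it exists by is_linear_span_lspan. *)
Definition lspan (S : set V) : {vspace V} := xget 0%VS (is_linear_span S).

Lemma finite_spanning (S : set V) : exists e : seq V,
  (forall x, x \in e -> S x) /\ forall x, S x -> x \in <<e>>%VS.
Proof.
pose P m := `[< exists e : seq V,
  (forall x, x \in e -> S x) /\ \dim <<e>>%VS = m >].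
have exP : exists m, P m.
  by exists (\dim <<[::] : seq V>>%VS); apply/asboolP; exists [::].
have ubP m : P m -> (m <= \dim {: V})%N.
  by move=> /asboolP[e [_ <-]]; apply: dimvS; exact: subvf.
case: (ex_maxnP exP ubP) => m /asboolP[e [eS dims]] maxm.
exists e; split=> // x Sx.
have le : (\dim <<x :: e>>%VS <= \dim <<e>>%VS)%N.
  rewrite dims; apply: maxm; apply/asboolP; exists (x :: e); split=> // y.
  by rewrite inE => /orP[/eqP->|/eS].
have sub : (<<e>> <= <<x :: e>>)%VS by rewrite span_cons addvSr.
have /eqP -> : <<e>>%VS == <<x :: e>>%VS by rewrite eqEdim sub le.
by apply: memv_span; rewrite mem_head.
Qed.

Lemma is_linear_span_lspan (S : set V) : is_linear_span S (lspan S).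
Proof.
apply: (@xgetPex _ 0%VS (is_linear_span S)).
have [e [eS Se]] := finite_spanning S.
exists <<e>>%VS; split=> // U' SU'.
by apply/span_subvP => x /eS /SU'.
Qed.

Lemma mem_lspan (S : set V) : S 0 ->
  (forall a x y, S x -> S y -> S (a *: x + y)) ->
  forall x, x \in lspan S <-> S x.
Proof.
move=> S0 Slin x; have [Ssub Smin] := is_linear_span_lspan S.
split=> [xS|]; last exact: Ssub.
have [e [eS /Smin/subvP/(_ _ xS)]] := finite_spanning S.
elim: e eS x {xS} => [_ x|y e IHs eS x].
  by rewrite span_nil memv0 => /eqP->.
rewrite span_cons => /memv_addP[_ /vlineP[a ->] [z zs ->]].
apply: Slin; first by apply: eS; rewrite mem_head.
by apply: IHs => // w ws; apply: eS; rewrite inE ws orbT.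
Qed.

End LinearSpan.

(* Linear algebraic groups over the complex numbers R[i], realised as Zariski
   closed subgroups of GL_n. *)
Section AlgebraicGroups.
Variables (R : realType) (n : nat).
Local Notation C := R[i].
Local Notation Mn := 'M[C]_n.

Definition mxeval (p : mpoly.mpoly (n * n) C) (A : Mn) : C :=
  mpoly.meval (fun k => mxvec A 0 k) p.

(* The closed subsets of GL_n are cut out by polynomials in the matrix
   entries alone, 1 / det being invertible on GL_n. *)
Definition zariski_closed (F : set Mn) : Prop :=
  exists I : set (mpoly.mpoly (n * n) C),
    F = [set A | A \in unitmx /\ forall p, I p -> mxeval p A = 0].

Definition algebraic_group (G : set Mn) : Prop :=
  [/\ zariski_closed G, G 1%:M,
      forall A B, G A -> G B -> G (A *m B) &
      forall A, G A -> G (invmx A)].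

Definition zariski_connected (G : set Mn) : Prop :=
  forall F1 F2, zariski_closed F1 -> zariski_closed F2 ->
    G = F1 `|` F2 -> F1 `&` F2 = set0 -> F1 = set0 \/ F2 = set0.

Definition Ad (x A : Mn) : Mn := x *m A *m invmx x.

Definition unipotent (u : Mn) : Prop := exists k, (u - 1%:M) ^+ k = 0.

Definition connected_reductive (G : set Mn) : Prop :=
  [/\ algebraic_group G, zariski_connected G &
      forall U, algebraic_group U -> zariski_connected U -> U `<=` G ->
        (forall x u, G x -> U u -> U (Ad x u)) ->
        (forall u, U u -> unipotent u) -> U = [set 1%:M]].

Definition torus (T : set Mn) : Prop :=
  [/\ algebraic_group T, zariski_connected T &
      exists2 P : Mn, P \in unitmx & forall A, T A -> is_diag_mx (Ad P A)].

Definition maximal_torus (G T : set Mn) : Prop :=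
  [/\ torus T, T `<=` G &
      forall T', torus T' -> T `<=` T' -> T' `<=` G -> T' = T].

(* The differential at the identity of every polynomial vanishing on G
   vanishes at X. *)
Definition tangent_at_1 (G : set Mn) : set Mn :=
  [set X | forall p, (forall A, G A -> mxeval p A = 0) ->
     \sum_(k < n * n) mxvec X 0 k * mxeval (mpoly.mderiv k p) 1%:M = 0].

Definition lie_alg (G : set Mn) : {vspace Mn} := lspan (tangent_at_1 G).

Lemma mem_lie_alg (G : set Mn) (X : Mn) :
  X \in lie_alg G <-> tangent_at_1 G X.
Proof.
apply: mem_lspan => [p _|a A B GA GB p Gp].
  by apply: big1 => k _; rewrite linear0 mxE mul0r.
under eq_bigr => k _ do rewrite linearP !mxE mulrDl -mulrA.
by rewrite big_split /= -mulr_sumr GA // GB // mulr0 addr0.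
Qed.

Definition bracket (X Y : Mn) : Mn := X *m Y - Y *m X.

Definition lie_derived (g : {vspace Mn}) : {vspace Mn} :=
  lspan [set Z | exists X Y, [/\ X \in g, Y \in g & Z = bracket X Y]].

Definition lie_center (g : {vspace Mn}) : {vspace Mn} :=
  lspan [set X | X \in g /\ forall Y, Y \in g -> bracket X Y = 0].

Lemma mem_lie_center (g : {vspace Mn}) (X : Mn) :
  X \in lie_center g <-> X \in g /\ forall Y, Y \in g -> bracket X Y = 0.
Proof.
apply: (mem_lspan (S := [set X | X \in g /\
  forall Y, Y \in g -> bracket X Y = 0])).
  by split=> [|Y _]; rewrite ?mem0v // /bracket mul0mx mulmx0 subr0.
move=> a A B [Ag cA] [Bg cB]; split=> [|Y Yg]; first by rewrite memvD ?memvZ.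
have := cA _ Yg; have := cB _ Yg; rewrite /bracket => /subr0_eq hB /subr0_eq hA.
by rewrite mulmxDl mulmxDr -scalemxAl -scalemxAr hA hB subrr.
Qed.

Definition root_system (g t : {vspace Mn}) : set 'Hom(subvs_of t, C^o) :=
  [set alpha | alpha != 0 /\
     exists X : Mn, [/\ X \in g, X != 0 &
       forall h : subvs_of t, bracket (vsval h) X = (alpha h : C) *: X]].

(* W = N_G(T) / T, viewed through its faithful adjoint action on t. *)
Definition weyl_group (G T : set Mn) : set 'End(subvs_of (lie_alg T)) :=
  [set w | exists x, [/\ G x, [set Ad x A | A in T] = T &
     forall h : subvs_of (lie_alg T), vsval (w h) = Ad x (vsval h)]].

Definition cartan_derived (G T : set Mn) : {vspace Mn} :=
  (lie_alg T :&: lie_derived (lie_alg G))%VS.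

Definition root_system_derived (G T : set Mn) :
    set 'Hom(subvs_of (cartan_derived G T), C^o) :=
  @root_system (lie_derived (lie_alg G)) (cartan_derived G T).

(* phi is the element (f, phi') of GL(Z(g)) x GL(t'), as an endomorphism of
   t = Z(g) (+) t'. *)
Definition is_direct_sum (z t' t : {vspace Mn}) (f : 'End(subvs_of z))
    (phi' : 'End(subvs_of t')) (phi : 'End(subvs_of t)) : Prop :=
  (forall (x : subvs_of z) (h : subvs_of t),
     vsval h = vsval x -> vsval (phi h) = vsval (f x)) /\
  (forall (x : subvs_of t') (h : subvs_of t),
     vsval h = vsval x -> vsval (phi h) = vsval (phi' x)).

End AlgebraicGroups.

Arguments root_system {R n} g t.
Arguments weyl_group {R n} G T.
Arguments root_system_derived {R n} G T.

Section RootsAndIrregularTypes.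
Variables (R : realType) (V : vectType R[i]).
Local Notation C := R[i].
Local Notation dual := 'Hom(V, C^o).

Definition is_base (Phi : set dual) (Delta : seq dual) : Prop :=
  [/\ free Delta, forall b, b \in Delta -> Phi b &
      forall a, Phi a -> exists c : nat -> nat,
        a = \sum_(i < size Delta) Delta`_i *+ c i \/
        a = - \sum_(i < size Delta) Delta`_i *+ c i].

Definition root_aut (Phi : set dual) (u : 'End(V)) : Prop :=
  lker u == 0%VS /\ [set (a \o u)%VF | a in Phi] = Phi.

(* Out(Phi), as the subgroup of Aut(Phi) preserving the base Delta. *)
Definition root_outer (Phi : set dual) (Delta : seq dual) (u : 'End(V)) : Prop :=
  root_aut Phi u /\ forall b, b \in Delta -> (b \o u)%VF \in Delta.

Definition finite_order_aut (f : 'End(V)) : Prop :=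
  lker f == 0%VS /\ exists2 k, (0 < k)%N & forall x, iter k f x = x.

Definition zeta (r : nat) : C :=
  (cos (2 * pi / r%:R) +i* sin (2 * pi / r%:R))%C.

(* Q : irregular_type s stands for the sum over i < s of (Q i) w ^ - (i + 1):
   the coefficient A_i of the mathematical notation is Q (i - 1). *)
Definition irregular_type (s : nat) : Type := 'I_s -> V.

Definition galois_generated (phi g' : 'End(V)) (r s : nat)
    (Q : irregular_type s) : Prop :=
  forall i : 'I_s, (phi \o g')%VF (Q i) = zeta r ^+ i.+1 *: Q i.

Definition galois_closed (W : set 'End(V)) (phi : 'End(V)) (r s : nat)
    (Q : irregular_type s) : Prop :=
  exists2 g', W g' & galois_generated phi g' r Q.

(* alpha(Q) is a polynomial in w^-1 without constant term; its pole order
   in w is its degree in 'X = w^-1 (and 0 if it vanishes). *)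
Definition root_part (s : nat) (alpha : dual) (Q : irregular_type s) : {poly C} :=
  \sum_(i < s) (alpha (Q i) : C) *: 'X^(i.+1).

Definition pole_order (s : nat) (alpha : dual) (Q : irregular_type s) : nat :=
  (size (root_part alpha Q)).-1.

Definition deformation_space (Phi : set dual) (phi g' : 'End(V)) (r s : nat)
    (Q : irregular_type s) : set (irregular_type s) :=
  [set Q' | galois_generated phi g' r Q' /\
     forall alpha, Phi alpha -> pole_order alpha Q' = pole_order alpha Q].

(* phi_i for 1 <= i <= s + 1; for i = s + 1 the condition is void, so that
   levi Phi Q s.+1 = Phi. *)
Definition levi (Phi : set dual) (s : nat) (Q : irregular_type s) (i : nat) :
    set dual :=
  [set alpha | Phi alpha /\ forall j : 'I_s, (i <= j.+1)%N -> alpha (Q j) = 0].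

Definition hyperplane (alpha : dual) : set V := [set h | alpha h = 0].

Definition ker_space (A : set dual) : set V :=
  \bigcap_(alpha in A) hyperplane alpha.

(* The eigenspace U(g_U, c) of the restriction g_U of g to a g-stable
   subspace U, as a subset of the ambient space. *)
Definition eigenspace_on (U : set V) (g : 'End(V)) (c : C) : set V :=
  [set h | U h /\ g h = c *: h].

Definition deformation_factor (Phi : set dual) (g : 'End(V)) (r s : nat)
    (Q : irregular_type s) (i : nat) : set V :=
  let E := eigenspace_on (ker_space (levi Phi Q i)) g (zeta r ^+ i) in
  E `\` \bigcup_(alpha in levi Phi Q i.+1 `\` levi Phi Q i)
          (hyperplane alpha `&` E).

End RootsAndIrregularTypes.

(* Main.v *)
(** The pole order of [alpha(Q)] is at most [i] exactly when [alpha] lies in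
    [phi_(i+1)], so it equals [i] exactly when [alpha] lies in
    [phi_(i+1) \ phi_i].  Prescribing all pole orders therefore amounts to
    separate conditions on the coefficients: [A_i] is killed by [phi_i] and by
    no root of [phi_(i+1) \ phi_i]. *)

Require Import Defs.
From mathcomp Require Import all_boot all_order all_algebra.
From mathcomp Require Import all_classical all_reals all_analysis.
From mathcomp Require Import complex.
Import Order.TTheory GRing.Theory Num.Theory.
Local Open Scope classical_set_scope.
Local Open Scope ring_scope.

Section PoleOrders.
Variables (R : realType) (V : vectType R[i]) (s : nat).
Implicit Types (alpha : 'Hom(V, R[i]^o)) (Q : irregular_type V s).

Lemma coef_root_part alpha Q (j : 'I_s) :
  (root_part alpha Q)`_j.+1 = alpha (Q j).
Proof.
rewrite /root_part coef_sum (bigD1 j) //= coefZ coefXn eqxx mulr1.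
rewrite big1 ?addr0 // => k nkj.
by rewrite coefZ coefXn eqSS eq_sym (inj_eq val_inj) (negPf nkj) mulr0.
Qed.

Lemma size_root_part alpha Q : (size (root_part alpha Q) <= s.+1)%N.
Proof.
apply: (leq_trans (size_sum _ _ _)); apply/bigmax_leqP => i _.
by apply: (leq_trans (size_scale_leq _ _)); rewrite size_polyXn ltnS.
Qed.

(** The range starts at [j = i] because [Q j] sits in degree [j+1]. The bound reads [size <= i+1],
    which the zero polynomial also meets. *)
Lemma pole_order_leP alpha Q (i : nat) :
  (pole_order alpha Q <= i)%N <->
  forall j : 'I_s, (i <= j)%N -> alpha (Q j) = 0.
Proof.
rewrite /pole_order -subn1 leq_subLR add1n; split.
  by move/leq_sizeP => le j ij; rewrite -coef_root_part le.
move=> Q0; apply/leq_sizeP => -[|k] // ik.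
(* Degrees above [s] carry no [Q j]; there the size bound gives 0. *)
have [ks|sk] := ltnP k s; last first.
  by apply: (leq_sizeP _ _ (size_root_part alpha Q)).
exact: (etrans (coef_root_part alpha Q (Ordinal ks)) (Q0 (Ordinal ks) ik)).
Qed.

Lemma pole_order_max alpha Q : (pole_order alpha Q <= s)%N.
Proof. by rewrite /pole_order -subn1 leq_subLR add1n size_root_part. Qed.

Lemma leviP (Phi : set 'Hom(V, R[i]^o)) Q (i : nat) alpha :
  levi Phi Q i.+1 alpha <-> Phi alpha /\ (pole_order alpha Q <= i)%N.
Proof. by split=> -[Pa /pole_order_leP]. Qed.

(** The Galois condition bears on each coefficient separately and is the eigenvector part of the
    factors; only the pole orders need an argument. *)
Lemma deformation_space_prod (Phi : set 'Hom(V, R[i]^o)) (phi g' : 'End(V))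
    (r : nat) Q :
  deformation_space Phi phi g' r Q =
  [set Q' | forall i : 'I_s,
     deformation_factor Phi (phi \o g')%VF r Q i.+1 (Q' i)].
Proof.
apply/seteqP; split=> Q' /=.
  move=> [gQ' dQ'] i; split.
    split; last exact: gQ'.
    move=> alpha /leviP[Pa]; rewrite -dQ' // => /pole_order_leP; exact.
  (* Here [alpha] has pole order exactly [i+1] on [Q], but killing [Q' i] would lower the order on
     [Q'], which is the same, to at most [i]. *)
  move=> [alpha [/leviP[Pa le_i1] nle_i] [/= Q'i0 _]]; apply: nle_i.
  apply/leviP; split=> //; rewrite -dQ' //; apply/pole_order_leP => j.
  rewrite leq_eqVlt => /orP[/eqP/val_inj<- //|].
  by move: le_i1; rewrite -dQ' // => /pole_order_leP; apply.
move=> facQ'; split=> [i|alpha Pa]; first by case: (facQ' i) => -[].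
have le : (pole_order alpha Q' <= pole_order alpha Q)%N.
  apply/pole_order_leP => j dj; case: (facQ' j) => -[kerj _] _.
  by apply: kerj; apply/leviP.
apply/eqP; rewrite eqn_leq le /=; case: leqP => // lt; exfalso.
(* If the order dropped, that of [Q] would be some [k+1 <= s], so [k] indexes a factor. That factor
   removes the hyperplane of [alpha], while the smaller order puts [Q' k] on it. *)
have ds := pole_order_max alpha Q.
case dE: (pole_order alpha Q) => [|k] in le lt ds; first by [].
have [Ek] := facQ' (Ordinal ds); apply; exists alpha.
  by split; [apply/leviP; rewrite dE | move=> /leviP[_]; rewrite dE ltnn].
by split=> //; move/pole_order_leP: lt; apply.
Qed.

End PoleOrders.

Theorem mainTheorem5 (R : realType) (n : nat) (G T : set 'M[R[i]]_n)
  (hG : connected_reductive G) (hT : maximal_torus G T)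
  (Delta : seq 'Hom(subvs_of (cartan_derived G T), R[i]^o))
  (hDelta : is_base (root_system_derived G T) Delta)
  (f : 'End(subvs_of (lie_center (lie_alg G))))
  (hf : finite_order_aut f)
  (phi' : 'End(subvs_of (cartan_derived G T)))
  (hphi' : root_outer (root_system_derived G T) Delta phi')
  (phi : 'End(subvs_of (lie_alg T)))
  (hphi : is_direct_sum f phi' phi)
  (r s : nat) (hr : (1 <= r)%N) (hs : (1 <= s)%N)
  (Q : irregular_type (subvs_of (lie_alg T)) s)
  (hQ : galois_closed (weyl_group G T) phi r Q)
  (g' : 'End(subvs_of (lie_alg T)))
  (hW : weyl_group G T g') (hg' : galois_generated phi g' r Q) :
  let Phi := root_system (lie_alg G) (lie_alg T) in
  let g := (phi \o g')%VF in
  deformation_space Phi phi g' r Q =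
  [set Q' | forall i : 'I_s, deformation_factor Phi g r Q i.+1 (Q' i)].
Proof.
exact: deformation_space_prod.
Qed.
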